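(* Let $T$ be a preprocessed text and let $P$ be a pattern that occurs in $T$. Let $P'$ be obtained from $P$ by editing its $i$-th character, i.e., either inserting a character $c$ at position $i$ or deleting the character at position $i$. Given $|P|$ and $\mathcal{SR}(P,T)$ (and, in the case of an insertion, the character $c$), one can compute $\mathcal{SR}(P',T)$ in $\mathcal{O}(\log |T|)$ time.
   Context: Strings are indexed from $0$; $T_p$ denotes the suffix of $T$ starting at position $p$; $lcp(X,Y)$ is the length of the longest common prefix. The suffix array $\mathcal{SA}$ of $T$ has $\mathcal{SA}[i]$ equal to the starting index of the $i$-th smallest suffix of $T$ in lexicographic order (from $i=0$); $\mathcal{ISA}$ is its inverse; the lcp array is $\mathcal{LCP}[i] = lcp(T_{\mathcal{SA}[i]}, T_{\mathcal{SA}[i+1]})$. Preprocessing of $T$ consists of computing $\mathcal{SA}$, $\mathcal{ISA}$, $\mathcal{LCP}$ and a constant-time range-minimum-query structure on $\mathcal{LCP}$ (all in $\mathcal{O}(|T|)$ time, alphabet of integers bounded by $|T|^c$, $c$ constant). Letting $S$ be the set of indices at which a string $Q$ occurs in $T$, its suffix range is $\mathcal{SR}(Q,T) = \{ i : \mathcal{SA}[i] \in S\}$, a set of consecutive indices represented as a half-open range $[\ell,r)$, and represented as the empty range $[0,0)$ when $Q$ does not occur in $T$. *)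

(* Defs.v *)
From mathcomp Require Import all_boot all_order.

Set Implicit Arguments.
Unset Strict Implicit.
Unset Printing Implicit Defensive.

Import Order.TTheory.

Notation string := (seq nat).

Definition lcp (X Y : string) : nat :=
  \max_(k < (minn (size X) (size Y)).+1 | take k X == take k Y) k.

(* In the lexicographic order of [seqlexi], a proper prefix comes first.  Only
   the nonempty suffixes, at positions 0, ..., |T| - 1, are sorted. *)
Definition suffix_array (T : string) : seq nat :=
  sort (fun p q => ((drop p T : seqlexi nat) <= (drop q T : seqlexi nat))%O)
       (iota 0 (size T)).

Definition inverse_suffix_array (T : string) : seq nat :=
  mkseq (fun p => index p (suffix_array T)) (size T).

Definition lcp_array (T : string) : seq nat :=
  mkseq (fun i => lcp (drop (nth 0 (suffix_array T) i) T)
                      (drop (nth 0 (suffix_array T) i.+1) T))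
        (size T).-1.

(* Leftmost position of the minimum of s[a], ..., s[b - 1] (a if there is none). *)
Definition range_min (s : seq nat) (a b : nat) : nat :=
  let w := drop a (take b s) in a + index (foldr minn (head 0 w) w) w.

Definition occurs_at (Q T : string) (p : nat) : bool :=
  (p < size T) && prefix Q (drop p T).

Definition occurs (Q T : string) : Prop := exists p, occurs_at Q T p.

Definition in_suffix_range (Q T : string) (i : nat) : bool :=
  (i < size T) && occurs_at Q T (nth 0 (suffix_array T) i).

(* [l, r) is the representation of SR(Q,T). *)
Definition suffix_range (Q T : string) (l r : nat) : Prop :=
  (occurs Q T -> forall i, in_suffix_range Q T i = (l <= i < r)) /\
  (~ occurs Q T -> l = 0 /\ r = 0).

Inductive edit := Insert of nat | Delete.

Definition edit_valid (P : string) (i : nat) (e : edit) : bool :=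
  if e is Insert _ then i <= size P else i < size P.

Definition apply_edit (P : string) (i : nat) (e : edit) : string :=
  if e is Insert c then take i P ++ c :: drop i P
  else take i P ++ drop i.+1 P.

Definition edit_letters (e : edit) : string :=
  if e is Insert c then [:: c] else [::].

(* Programs of a unit-cost random access machine whose registers R[0], R[1], ...
   hold natural numbers, with indirect addressing; the four arrays of the
   preprocessed text T and the range-minimum structure on its lcp array are
   read-only and are queried at unit cost.

   The only arithmetic operations are addition, truncated subtraction and
   halving, so that t steps multiply the largest number present by at most 2^t.
   In O(log |T|) steps from inputs that are polynomial in |T|, all numbers thus
   stay polynomial in |T|, i.e. they fit in O(1) words of Theta(log |T|) bits:
   unit cost is no more generous than the word RAM. *)
Definition reg := nat.

Inductive prog :=
| Const (d : reg) (v : nat)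
| Copy (d a : reg)
| Add (d a b : reg)
| Sub (d a b : reg)
| Half (d a : reg)
| GetInd (d a : reg)
| SetInd (a b : reg)
| ReadT (d a : reg)
| ReadSA (d a : reg)
| ReadISA (d a : reg)
| ReadLCP (d a : reg)
| RMQ (d a b : reg)
| Seq (p q : prog)
| IfLt (a b : reg) (p q : prog)
| WhileLt (a b : reg) (p : prog).

Definition memory := reg -> nat.

Definition upd (R : memory) (d : reg) (v : nat) : memory :=
  fun x => if x == d then v else R x.

(* [exec T p R t R'] : on the preprocessed text T, p started in memory R
   terminates in memory R' after exactly t steps (every operation, query and
   test is one step).  Reading an array out of bounds yields 0. *)
Inductive exec (T : string) : prog -> memory -> nat -> memory -> Prop :=
| exec_Const d v R : exec T (Const d v) R 1 (upd R d v)
| exec_Copy d a R : exec T (Copy d a) R 1 (upd R d (R a))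
| exec_Add d a b R : exec T (Add d a b) R 1 (upd R d (R a + R b))
| exec_Sub d a b R : exec T (Sub d a b) R 1 (upd R d (R a - R b))
| exec_Half d a R : exec T (Half d a) R 1 (upd R d (R a)./2)
| exec_GetInd d a R : exec T (GetInd d a) R 1 (upd R d (R (R a)))
| exec_SetInd a b R : exec T (SetInd a b) R 1 (upd R (R a) (R b))
| exec_ReadT d a R : exec T (ReadT d a) R 1 (upd R d (nth 0 T (R a)))
| exec_ReadSA d a R :
    exec T (ReadSA d a) R 1 (upd R d (nth 0 (suffix_array T) (R a)))
| exec_ReadISA d a R :
    exec T (ReadISA d a) R 1 (upd R d (nth 0 (inverse_suffix_array T) (R a)))
| exec_ReadLCP d a R :
    exec T (ReadLCP d a) R 1 (upd R d (nth 0 (lcp_array T) (R a)))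
| exec_RMQ d a b R :
    exec T (RMQ d a b) R 1 (upd R d (range_min (lcp_array T) (R a) (R b)))
| exec_Seq p q R R1 R2 t1 t2 :
    exec T p R t1 R1 -> exec T q R1 t2 R2 -> exec T (Seq p q) R (t1 + t2) R2
| exec_IfLt_true a b p q R t R1 :
    R a < R b -> exec T p R t R1 -> exec T (IfLt a b p q) R t.+1 R1
| exec_IfLt_false a b p q R t R1 :
    R b <= R a -> exec T q R t R1 -> exec T (IfLt a b p q) R t.+1 R1
| exec_WhileLt_true a b p R R1 R2 t1 t2 :
    R a < R b -> exec T p R t1 R1 -> exec T (WhileLt a b p) R1 t2 R2 ->
    exec T (WhileLt a b p) R (t1 + t2).+1 R2
| exec_WhileLt_false a b p R :
    R b <= R a -> exec T (WhileLt a b p) R 1 R.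

(* Registers 0 to 6 initially hold |T|, |P|, the bounds l and r of SR(P,T), the
   position i, the kind of edit (0 = insertion, 1 = deletion) and the inserted
   letter (0 for a deletion); all the other registers hold 0. *)
Definition input (T : string) (m l r i : nat) (e : edit) : memory :=
  nth 0 [:: size T; m; l; r; i;
            (if e is Insert _ then 0 else 1); (if e is Insert c then c else 0)].

Lemma exec_det T p R t1 R1 t2 R2 :
  exec T p R t1 R1 -> exec T p R t2 R2 -> t1 = t2 /\ R1 = R2.
Proof.
move=> H; elim: H t2 R2 => {p R t1 R1}.
1-12: by move=> *; match goal with H : exec _ _ _ _ _ |- _ => inversion H end.
- move=> p q R R1 R2 t1 t2 _ IH1 _ IH2 t3 R3 H; inversion H as
    [| | | | | | | | | | | | ? ? ? ? ? ? ? E1 E2 | | | |]; subst.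
  by have [? ?] := IH1 _ _ E1; subst; have [? ?] := IH2 _ _ E2; subst.
- move=> a b p q R t R1 lt_ab _ IH t2 R2 H; inversion H as
    [| | | | | | | | | | | | | ? ? ? ? ? ? ? _ E | ? ? ? ? ? ? ? le_ba _ | |];
    subst; first by have [? ?] := IH _ _ E; subst.
  by rewrite ltnNge le_ba in lt_ab.
- move=> a b p q R t R1 le_ba _ IH t2 R2 H; inversion H as
    [| | | | | | | | | | | | | ? ? ? ? ? ? ? lt_ab _ | ? ? ? ? ? ? ? _ E | |];
    subst; last by have [? ?] := IH _ _ E; subst.
  by rewrite ltnNge le_ba in lt_ab.
- move=> a b p R R1 R2 t1 t2 lt_ab _ IH1 _ IH2 t3 R3 H; inversion H as
    [| | | | | | | | | | | | | | | ? ? ? ? ? ? ? ? _ E1 E2 | ? ? ? ? le_ba];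
    subst; last by rewrite ltnNge le_ba in lt_ab.
  by have [? ?] := IH1 _ _ E1; subst; have [? ?] := IH2 _ _ E2; subst.
- move=> a b p R le_ba t2 R2 H; inversion H as
    [| | | | | | | | | | | | | | | ? ? ? ? ? ? ? ? lt_ab _ _ |]; subst => //.
  by rewrite ltnNge le_ba in lt_ab.
Qed.

Lemma prefix_between (Q x y z : string) :
  prefix Q x -> prefix Q z ->
  ((x : seqlexi nat) <= (y : seqlexi nat))%O ->
  ((y : seqlexi nat) <= (z : seqlexi nat))%O -> prefix Q y.
Proof.
elim: Q x y z => [|c Q IH] [|a x] [|b y] [|d z] //=.
case/andP=> /eqP <- Qx /andP[/eqP <- Qz].
rewrite !lexi_cons => /andP[le_cb /implyP le_xy] /andP[le_bc /implyP le_yz].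
have /eqP eq_cb : c == b by rewrite eq_le le_cb le_bc.
by rewrite eq_cb eqxx (IH _ _ _ Qx Qz) ?le_xy ?le_yz.
Qed.

Lemma suffix_range_exists (Q T : string) : exists l r, suffix_range Q T l r.
Proof.
set leT := fun p q => ((drop p T : seqlexi nat) <= (drop q T : seqlexi nat))%O.
have leT_tr : transitive leT by move=> q p s; apply: le_trans.
have szS : size (suffix_array T) = size T by rewrite size_sort size_iota.
have sortS : sorted leT (suffix_array T).
  by apply: sort_sorted => p q; apply: le_total.
have [/hasP[i _ Qi]|nQ] := boolP (has (in_suffix_range Q T) (iota 0 (size T))).
  have exQ : exists i, in_suffix_range Q T i by exists i.
  have ubQ j : in_suffix_range Q T j -> j <= size T by case/andP=> /ltnW.
  case: (ex_minnP exQ) => l Ql minl; case: (ex_maxnP exQ ubQ) => r Qr maxr.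
  exists l, r.+1; split=> [_ j|[]]; last first.
    by case/andP: Qi => _ Qi; exists (nth 0 (suffix_array T) i).
  apply/idP/andP => [Qj|[le_lj]]; first by rewrite minl //= ltnS maxr.
  rewrite ltnS => le_jr.
  case/andP: Ql => ltl /andP[_ Ql]; case/andP: Qr => ltr /andP[_ Qr].
  have ltj : j < size T by apply: leq_ltn_trans ltr.
  have mono a b : a <= b -> b < size T ->
      leT (nth 0 (suffix_array T) a) (nth 0 (suffix_array T) b).
    move=> le_ab ltb; apply: sorted_leq_nth => //; rewrite ?inE ?szS //.
      by move=> p; apply: lexx.
    exact: leq_ltn_trans ltb.
  rewrite /in_suffix_range /occurs_at ltj /=; apply/andP; split; last first.
    exact: (prefix_between Ql Qr (mono l j le_lj ltj) (mono j r le_jr ltr)).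
  have : nth 0 (suffix_array T) j \in suffix_array T by rewrite mem_nth ?szS.
  by rewrite mem_sort mem_iota.
exists 0, 0; split=> // -[p Qp]; case/negP: nQ.
have pS : p \in suffix_array T.
  by rewrite mem_sort mem_iota; case/andP: Qp.
have ltp : index p (suffix_array T) < size T by rewrite -szS index_mem.
apply/hasP; exists (index p (suffix_array T)); first by rewrite mem_iota.
by rewrite /in_suffix_range ltp nth_index.
Qed.

(* Main.v *)
(* Binary search in the suffix array.  An occurrence of P at position SA[l]
   exhibits P' as a concatenation of at most two factors of T and one letter.
   Comparing a suffix T_q with a factor T[s, s + len) takes constant time: the
   factor is a prefix of T_q iff lcp(T_q, T_s) >= len, where the lcp is a range
   minimum of the lcp array between the ranks of q and s; otherwise the first
   mismatch lies inside the factor, so the ranks of q and s decide.  Hence the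
   rank of P' among the suffixes, and the end of the block of suffixes having
   P' as a prefix, are each found in log |T| rounds. *)

Require Import Defs.
From mathcomp Require Import all_boot all_order.
From mathcomp Require Import zify.

Set Implicit Arguments.
Unset Strict Implicit.
Unset Printing Implicit Defensive.

Import Order.TTheory.

(** * Comparing a string with a pattern *)

(* 0 if U is smaller than every string with prefix X, 1 if X is a prefix of U,
   2 if U is larger than every string with prefix X. *)
Fixpoint prefix_cmp (U X : string) : nat :=
  match X, U with
  | [::], _ => 1
  | _ :: _, [::] => 0
  | x :: X', u :: U' =>
      if u < x then 0 else if x < u then 2 else prefix_cmp U' X'
  end.

Lemma prefix_cmp0 U : prefix_cmp U [::] = 1.
Proof. by case: U. Qed.

Lemma prefix_cmp_le2 U X : prefix_cmp U X <= 2.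
Proof. by elim: X U => [|x X IH] [|u U] //=; case: ltngtP. Qed.

Lemma prefix_cmp_eq1 U X : (prefix_cmp U X == 1) = prefix X U.
Proof.
elim: X U => [|x X IH] [|u U] //=.
by case: ltngtP => //= ->; rewrite IH.
Qed.

(** The strings below, inside and above the block of strings with prefix [X] form three consecutive
    intervals of the lexicographic order. Along the suffix array the code is thus nondecreasing, and
    its jumps to at least 1 and to 2 are the two ends of the suffix range. *)
Lemma prefix_cmp_mono U V X :
  ((U : seqlexi nat) <= (V : seqlexi nat))%O -> prefix_cmp U X <= prefix_cmp V X.
Proof.
elim: X U V => [|x X IH] [|u U] [|v V] //.
rewrite lexi_cons => /andP[le_uv /implyP le_UV] /=.
rewrite leEnat in le_uv le_UV.
case: (ltngtP u x) => // [lt_xu|eq_ux].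
  by case: (ltngtP v x) => //; lia.
subst x; case: (ltngtP v u) le_uv => // [_ _|eq_vu _].
  exact: prefix_cmp_le2.
by apply: IH; apply: le_UV; rewrite eq_vu.
Qed.

(** Either a mismatch or the end of [U] inside [X] settles the comparison, or it resumes behind [X].
    This allows a pattern to be compared piece by piece. *)
Lemma prefix_cmp_cat U X Y :
  prefix_cmp U (X ++ Y) =
  if prefix_cmp U X == 1 then prefix_cmp (drop (size X) U) Y
  else prefix_cmp U X.
Proof.
elim: X U => [|x X IH] [|u U] //=.
by case: ltngtP.
Qed.

(** Agreement on a prefix is inherited by all shorter ones, so the maximum can be replaced by a
    threshold test; later arguments use [lcp] mostly through such tests. *)
Lemma leq_lcp k X Y :
  (k <= lcp X Y) = [&& k <= size X, k <= size Y & take k X == take k Y].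
Proof.
apply/idP/idP => [le_k|/and3P[kX kY eqk]]; last first.
  have ltk : k < (minn (size X) (size Y)).+1 by rewrite ltnS leq_min kX.
  exact: (leq_bigmax_cond (Ordinal ltk)).
rewrite /lcp in le_k.
have P0 : [pred j : 'I_(minn (size X) (size Y)).+1 | take j X == take j Y] ord0.
  by rewrite /= !take0.
move: le_k; rewrite (bigop.bigmax_eq_arg ord0 P0).
case: arg_maxnP => // j /eqP eqj _ le_kj.
have := ltn_ord j; rewrite ltnS leq_min => /andP[jX jY].
rewrite (leq_trans le_kj jX) (leq_trans le_kj jY) /=.
by rewrite -(take_takel X le_kj) -(take_takel Y le_kj) eqj.
Qed.

Lemma prefix_take_lcp k X Y :
  k <= size Y -> prefix (take k Y) X = (k <= lcp X Y).
Proof.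
move=> kY; rewrite leq_lcp kY /= prefixE size_takel //.
case: (leqP k (size X)) => //= ltX; apply/negbTE/eqP => eqk.
by move: ltX; rewrite -(size_takel kY) -eqk size_take_min ltnNge geq_minr.
Qed.

Lemma lcpC : commutative lcp.
Proof.
have le X Y : lcp X Y <= lcp Y X.
  have := leqnn (lcp X Y); rewrite !leq_lcp => /and3P[-> ->].
  by rewrite eq_sym => ->.
by move=> X Y; apply/eqP; rewrite eqn_leq !le.
Qed.

(** [V] itself has code 1, so by monotonicity [U] has code at most 1; the lcp tells which of the two
    values it is. *)
Lemma prefix_cmp_take_le k U V :
  k <= size V -> ((U : seqlexi nat) <= (V : seqlexi nat))%O ->
  prefix_cmp U (take k V) = if lcp U V < k then 0 else 1.
Proof.
move=> kV /(prefix_cmp_mono (take k V)).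
have /eqP-> : prefix_cmp V (take k V) == 1 by rewrite prefix_cmp_eq1 prefix_take.
rewrite [lcp U V < k]ltnNge -(prefix_take_lcp _ kV) -prefix_cmp_eq1.
by case: (prefix_cmp _ _) => [|[|]].
Qed.

Lemma prefix_cmp_take_ge k U V :
  k <= size V -> ((V : seqlexi nat) <= (U : seqlexi nat))%O ->
  prefix_cmp U (take k V) = if lcp U V < k then 2 else 1.
Proof.
move=> kV /(prefix_cmp_mono (take k V)).
have /eqP-> : prefix_cmp V (take k V) == 1 by rewrite prefix_cmp_eq1 prefix_take.
rewrite [lcp U V < k]ltnNge -(prefix_take_lcp _ kV) -prefix_cmp_eq1.
by have := prefix_cmp_le2 U (take k V); case: (prefix_cmp _ _) => [|[|[|]]].
Qed.

(** * Suffix arrays *)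

Notation SA T := (suffix_array T).
Notation nsuffix T j := (drop (nth 0 (SA T) j) T).

Lemma size_suffix_array T : size (SA T) = size T.
Proof. by rewrite size_sort size_iota. Qed.

Lemma mem_suffix_array T p : (p \in SA T) = (p < size T).
Proof. by rewrite mem_sort mem_iota. Qed.

Lemma suffix_array_mono T a b : a <= b -> b < size T ->
  ((nsuffix T a : seqlexi nat) <= (nsuffix T b : seqlexi nat))%O.
Proof.
pose leT p q := ((drop p T : seqlexi nat) <= (drop q T : seqlexi nat))%O.
move=> le_ab ltb; apply: (@sorted_leq_nth _ leT) => //.
- by move=> q p s; apply: le_trans.
- by move=> p; apply: lexx.
- by apply: sort_sorted => p q; apply: le_total.
- by rewrite inE size_suffix_array (leq_ltn_trans le_ab).
- by rewrite inE size_suffix_array.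
Qed.

Lemma nth_inverse_suffix_array T q : q < size T ->
  nth 0 (inverse_suffix_array T) q < size T /\
  nth 0 (SA T) (nth 0 (inverse_suffix_array T) q) = q.
Proof.
move=> ltq; rewrite nth_mkseq // nth_index ?mem_suffix_array //.
by rewrite -size_suffix_array index_mem mem_suffix_array.
Qed.

Lemma leq_range_min s a b k : a < b -> b <= size s ->
  (k <= nth 0 s (range_min s a b)) = all (leq k) (drop a (take b s)).
Proof.
move=> lt_ab leb; rewrite /range_min.
set w := drop a (take b s).
have szw : size w = b - a by rewrite size_drop size_takel.
have w0 : 0 < size w by rewrite szw subn_gt0.
set mn := foldr minn (head 0 w) w.
(* The fold starts from the head of the window, so its result is an entry and [index] finds it. *)
have mn_in : mn \in w.
  rewrite /mn; case: w w0 {szw mn} => // x w _.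
  have aux v : foldr minn x v \in x :: v.
    elim: v => [|y v IH] /=; first exact: mem_head.
    rewrite /minn; case: ifP => _; first by rewrite !inE eqxx orbT.
    by move: IH; rewrite !inE => /orP[->|->]; rewrite ?orbT.
  rewrite /=; move: (aux w); rewrite /minn; case: ifP => // _ _; exact: mem_head.
have -> : nth 0 s (a + index mn w) = mn.
  rewrite -[RHS](nth_index 0 mn_in) {2}/w nth_drop nth_take //.
  by move: mn_in; rewrite -index_mem szw; lia.
(* Duplicating the condition on the head matches the initial value of the fold, which can then be
   generalised for the induction. *)
have -> : all (leq k) w = (k <= head 0 w) && all (leq k) w.
  by case: w w0 {szw mn mn_in} => //= x w _; case: (k <= x).
rewrite /mn; move: (head 0 w) => h; elim: (w) => [|x v IH] /=.
  by rewrite andbT.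
by rewrite leq_min IH andbCA.
Qed.

(** Threshold form of the classical fact that the lcp of two suffixes is the minimum of the lcps of
    neighbours between their ranks. In one direction equality of the first [k] letters is chained
    through the neighbours; in the other, all suffixes sorted between two that share a prefix share
    it too. *)
Lemma leq_lcp_array_range_min T a b k : a < b -> b < size T ->
  (k <= nth 0 (lcp_array T) (range_min (lcp_array T) a b)) =
  (k <= lcp (nsuffix T a) (nsuffix T b)).
Proof.
move=> lt_ab ltb; have szL : size (lcp_array T) = (size T).-1.
  exact: size_mkseq.
have leb : b <= size (lcp_array T) by rewrite szL; lia.
rewrite leq_range_min //.
have nthL j : j < b -> nth 0 (lcp_array T) j =
    lcp (nsuffix T j) (nsuffix T j.+1).
  by move=> ltj; rewrite nth_mkseq //; lia.
apply/(all_nthP 0)/idP => [allk|le_k j].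
  have step j : a <= j < b -> k <= lcp (nsuffix T j) (nsuffix T j.+1).
    move=> /andP[le_aj lt_jb]; rewrite -nthL //.
    have := allk (j - a); rewrite size_drop size_takel // nth_drop nth_take.
      by rewrite subnKC // => -> //; lia.
    by rewrite subnKC.
  have {}step d : a + d < b -> k <= lcp (nsuffix T a) (nsuffix T (a + d).+1).
    elim: d => [|d IH] ltd; first by rewrite addn0 step //; lia.
    have /and3P[ka _ /eqP eqa] : [&& k <= size (nsuffix T a),
        k <= size (nsuffix T (a + d).+1)
        & take k (nsuffix T a) == take k (nsuffix T (a + d).+1)].
      by rewrite -leq_lcp IH //; lia.
    have := step (a + d.+1).
    rewrite !leq_lcp addnS => /(_ _)/and3P[|_ -> /eqP <-].
      by lia.
    by rewrite ka eqa eqxx.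
  have := step (b - a).-1; rewrite -addnS prednK ?subn_gt0 //.
  by rewrite subnKC ?(ltnW lt_ab) //; apply; lia.
rewrite size_drop size_takel // => ltj.
rewrite nth_drop nth_take ?nthL; [|lia..].
move: le_k; rewrite leq_lcp => /and3P[ka kb /eqP eqk].
have Qa : prefix (take k (nsuffix T b)) (nsuffix T a) by rewrite -eqk prefix_take.
have Qb : prefix (take k (nsuffix T b)) (nsuffix T b) by rewrite prefix_take.
have szQ : size (take k (nsuffix T b)) = k by rewrite size_takel.
have between i : a <= i <= b ->
    k <= size (nsuffix T i) /\ take k (nsuffix T i) = take k (nsuffix T b).
  move=> /andP[le_ai le_ib].
  have Qi : prefix (take k (nsuffix T b)) (nsuffix T i).
    apply: (prefix_between Qa Qb); apply: suffix_array_mono => //; lia.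
  split; first by rewrite -{1}szQ size_prefix.
  by move: Qi; rewrite prefixE szQ => /eqP.
have [ka1 e1] := between (a + j) ltac:(lia).
have [ka2 e2] := between (a + j).+1 ltac:(lia).
by rewrite leq_lcp ka1 ka2 e1 e2 eqxx.
Qed.

(** * Loop-free programs *)

Notation "p ;; q" := (Seq p q) (at level 60, right associativity).

Fixpoint loop_free (p : prog) : bool :=
  match p with
  | Seq p q | IfLt _ _ p q => loop_free p && loop_free q
  | WhileLt _ _ _ => false
  | _ => true
  end.

(** A bound on the number of steps, taking the dearer branch of each test. The values of [cost] and
    [eval] on [WhileLt] are placeholders: [exec_eval] is restricted to [loop_free] programs. *)
Fixpoint cost (p : prog) : nat :=
  match p with
  | Seq p q => cost p + cost q
  | IfLt _ _ p q => (maxn (cost p) (cost q)).+1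
  | _ => 1
  end.

Fixpoint eval (T : string) (p : prog) (R : memory) : memory :=
  match p with
  | Const d v => upd R d v
  | Copy d a => upd R d (R a)
  | Add d a b => upd R d (R a + R b)
  | Defs.Sub d a b => upd R d (R a - R b)
  | Half d a => upd R d (R a)./2
  | GetInd d a => upd R d (R (R a))
  | SetInd a b => upd R (R a) (R b)
  | ReadT d a => upd R d (nth 0 T (R a))
  | ReadSA d a => upd R d (nth 0 (suffix_array T) (R a))
  | ReadISA d a => upd R d (nth 0 (inverse_suffix_array T) (R a))
  | ReadLCP d a => upd R d (nth 0 (lcp_array T) (R a))
  | RMQ d a b => upd R d (range_min (lcp_array T) (R a) (R b))
  | Seq p q => eval T q (eval T p R)
  | IfLt a b p q => if R a < R b then eval T p R else eval T q R
  | WhileLt _ _ _ => R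
  end.

Lemma eval_Seq T p q R : eval T (p ;; q) R = eval T q (eval T p R).
Proof. by []. Qed.

Lemma eval_IfLt T a b p q R :
  eval T (IfLt a b p q) R = if R a < R b then eval T p R else eval T q R.
Proof. by []. Qed.

Lemma exec_eval T p R : loop_free p ->
  exists2 t, exec T p R t (eval T p R) & t <= cost p.
Proof.
elim: p R => /=; try by move=> *; exists 1 => //; constructor.
- move=> p IHp q IHq R /andP[/(IHp R)[t Et let1] /(IHq (eval T p R))[u Eu leu]].
  by exists (t + u); [apply: exec_Seq Et Eu | apply: leq_add].
- move=> a b p IHp q IHq R /andP[/(IHp R)[t Et let1] /(IHq R)[u Eu leu]].
  case: ltnP => [lt_ab|le_ba].
    by exists t.+1; [apply: exec_IfLt_true | rewrite ltnS leq_max let1].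
  by exists u.+1; [apply: exec_IfLt_false | rewrite ltnS leq_max leu orbT].
Qed.

(* A program with an indirect store touches every register. *)
Fixpoint untouched (x : reg) (p : prog) : bool :=
  match p with
  | Const d _ | Copy d _ | Add d _ _ | Defs.Sub d _ _ | Half d _ | GetInd d _
  | ReadT d _ | ReadSA d _ | ReadISA d _ | ReadLCP d _ | RMQ d _ _ => x != d
  | SetInd _ _ => false
  | Seq p q | IfLt _ _ p q => untouched x p && untouched x q
  | WhileLt _ _ p => untouched x p
  end.

Lemma exec_untouched T p R t R' x :
  exec T p R t R' -> untouched x p -> R' x = R x.
Proof.
elim=> //= {p R t R'}; rewrite /upd; intros; repeat match goal with
  | H : is_true (_ != _) |- _ => rewrite (negbTE H)
  | H : is_true (_ && _) |- _ => case/andP: H => ? ? end; intuition congruence.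
Qed.

Lemma eval_untouched T p R x :
  loop_free p -> untouched x p -> eval T p R x = R x.
Proof. by move=> /(exec_eval T R)[t Et _]; apply: exec_untouched Et. Qed.

(** * The search program *)

(* Registers 0 to 6 are the input.  [rS1], [rI] and [rS2], [rLen2] delimit the
   two factors of T that surround the edited position. *)
Notation rN := 0.
Notation rM := 1.
Notation rL := 2.
Notation rI := 4.
Notation rK := 5.
Notation rC := 6.
Notation rZero := 7.
Notation rOne := 8.
Notation rS1 := 9.
Notation rS2 := 10.
Notation rLen2 := 11.
Notation rLeft := 12.
Notation rTh := 13.
Notation rLo := 14.
Notation rHi := 15.
Notation rMid := 16.
Notation rQ := 17.
Notation rOut := 18.
Notation rA := 19.
Notation rB := 20.
Notation rX := 21.

(** The outcome in [rOut] is coded as in [prefix_cmp]. The empty factor is treated first, since it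
    may start at |T|, where there is no rank; then a position [rQ] past the end, which stands for
    the empty suffix. Equal ranks mean that both positions coincide. *)
Definition cmp_factor (s len : reg) : prog :=
  IfLt rZero len
    (IfLt rQ rN
      (ReadISA rA rQ ;; ReadISA rB s ;;
       IfLt rA rB
         (RMQ rX rA rB ;; ReadLCP rX rX ;;
          IfLt rX len (Const rOut 0) (Const rOut 1))
         (IfLt rB rA
           (RMQ rX rB rA ;; ReadLCP rX rX ;;
            IfLt rX len (Const rOut 2) (Const rOut 1))
           (Const rOut 1)))
      (Const rOut 0))
    (Const rOut 1).

(** The bound test separates the end of the text from a letter 0, since an out-of-bounds read also
    yields 0. *)
Definition cmp_letter : prog :=
  IfLt rQ rN
    (ReadT rX rQ ;;
     IfLt rX rC (Const rOut 0) (IfLt rC rX (Const rOut 2) (Const rOut 1)))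
    (Const rOut 0).

(** [Copy rOut rOut] serves as a no-op that keeps the verdict of a mismatch. *)
Definition on_match (p : prog) : prog :=
  IfLt rOut rOne (Copy rOut rOut) (IfLt rOne rOut (Copy rOut rOut) p).

Definition cmp_rest : prog :=
  Add rQ rQ rI ;;
  IfLt rK rOne
    (cmp_letter ;; on_match (Add rQ rQ rOne ;; cmp_factor rS2 rLen2))
    (cmp_factor rS2 rLen2).

Definition cmp_pattern : prog := cmp_factor rS1 rI ;; on_match cmp_rest.

Definition bisect_step : prog :=
  Add rMid rLo rHi ;; Half rMid rMid ;; ReadSA rQ rMid ;; cmp_pattern ;;
  IfLt rOut rTh (Add rLo rMid rOne) (Copy rHi rMid).

Definition bisect (th : nat) : prog :=
  Const rTh th ;; Const rLo 0 ;; Copy rHi rN ;; WhileLt rLo rHi bisect_step.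

(** The kind of edit doubles as the number of deleted letters: the second factor starts [rI + rK]
    letters into the occurrence of [P]. *)
Definition locate_factors : prog :=
  Const rOne 1 ;; ReadSA rS1 rL ;; Add rS2 rS1 rI ;; Add rS2 rS2 rK ;;
  Defs.Sub rLen2 rM rI ;; Defs.Sub rLen2 rLen2 rK.

Definition output_range : prog :=
  IfLt rLeft rLo (Copy 0 rLeft ;; Copy 1 rLo) (Const 0 0 ;; Const 1 0).

Definition search_edited : prog :=
  locate_factors ;; bisect 1 ;; Copy rLeft rLo ;; bisect 2 ;; output_range.

(** * Correctness of the comparison with the edited pattern *)

Lemma eval_cmp_factor T R s len :
  s < rA -> len < rA -> R rZero = 0 -> R rN = size T ->
  R s + R len <= size T ->
  eval T (cmp_factor s len) R rOut =
  prefix_cmp (drop (R rQ) T) (take (R len) (drop (R s) T)).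
Proof.
move=> lts ltlen Z N le_sl.
have us x v (S : memory) : rA <= x -> upd S x v s = S s.
  by move=> lex; rewrite /upd ltn_eqF // (leq_trans lts lex).
have ulen x v (S : memory) : rA <= x -> upd S x v len = S len.
  by move=> lex; rewrite /upd ltn_eqF // (leq_trans ltlen lex).
rewrite /= Z N; case: ltnP => [len0|]; last first.
  by rewrite leqn0 => /eqP ->; rewrite take0 prefix_cmp0.
case: ltnP => [ltq|geq]; last first.
  rewrite drop_oversize //=; case E: (take _ _) => //.
  by have := congr1 size E; rewrite size_takel ?size_drop /=; lia.
rewrite !ulen // !us // /upd /=.
(* A nonempty factor inside the text starts at a position that has a rank. *)
have ltS : R s < size T by lia.
have kS : R len <= size (drop (R s) T) by rewrite size_drop; lia.
move: kS; have [] := nth_inverse_suffix_array ltq.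
have [] := nth_inverse_suffix_array ltS.
set a := nth 0 _ (R rQ); set b := nth 0 _ (R s) => ltb <- lta <- kS.
have lcp_lt c d : c < d -> d < size T ->
    (nth 0 (lcp_array T) (range_min (lcp_array T) c d) < R len) =
    (lcp (nsuffix T c) (nsuffix T d) < R len).
  by move=> lt_cd ltd; rewrite ltnNge leq_lcp_array_range_min // -ltnNge.
case: (ltngtP a b) => [lt_ab|lt_ba|->].
- rewrite lcp_lt // (prefix_cmp_take_le kS (suffix_array_mono (ltnW lt_ab) ltb)).
  by case: ifP.
- rewrite lcp_lt // (prefix_cmp_take_ge kS (suffix_array_mono (ltnW lt_ba) lta)).
  by rewrite lcpC; case: ifP.
- by apply/esym/eqP; rewrite prefix_cmp_eq1 prefix_take.
Qed.

Lemma eval_cmp_factor_frame T R s len x :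
  x < rOut -> eval T (cmp_factor s len) R x = R x.
Proof.
move=> ltx; have N d : rOut <= d -> x != d.
  by move=> led; rewrite neq_ltn (leq_trans ltx led).
by rewrite eval_untouched //= !N.
Qed.

Lemma eval_cmp_letter T R : R rN = size T ->
  eval T cmp_letter R rOut = prefix_cmp (drop (R rQ) T) [:: R rC].
Proof.
move=> N; rewrite /= N; case: ltnP => [ltq|geq]; last by rewrite drop_oversize.
rewrite (drop_nth 0 ltq) /upd /=.
by case: ltngtP => // _; rewrite prefix_cmp0.
Qed.

Lemma eval_cmp_letter_frame T R x :
  x < rOut -> eval T cmp_letter R x = R x.
Proof.
move=> ltx; have N d : rOut <= d -> x != d.
  by move=> led; rewrite neq_ltn (leq_trans ltx led).
by rewrite eval_untouched //= !N.
Qed.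

Definition decoded (T : string) (R : memory) : string :=
  take (R rI) (drop (R rS1) T) ++
  (if R rK < 1 then [:: R rC] else [::]) ++
  take (R rLen2) (drop (R rS2) T).

Definition well_formed (T : string) (R : memory) : Prop :=
  [/\ R rZero = 0, R rOne = 1, R rN = size T, R rS1 + R rI <= size T
    & R rS2 + R rLen2 <= size T].

Lemma eval_on_match T p R : R rOne = 1 ->
  eval T (on_match p) R rOut =
  if R rOut == 1 then eval T p R rOut else R rOut.
Proof.
move=> one; rewrite /= one; by case: (ltngtP (R rOut) 1).
Qed.

Lemma eval_cmp_pattern T R : well_formed T R ->
  eval T cmp_pattern R rOut = prefix_cmp (drop (R rQ) T) (decoded T R).
Proof.
case=> Z one N le1 le2; rewrite /decoded.
pose R1 := eval T (cmp_factor rS1 rI) R.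
have E1 x : x < rOut -> R1 x = R x by apply: eval_cmp_factor_frame.
have size1 : size (take (R rI) (drop (R rS1) T)) = R rI.
  by rewrite size_takel // size_drop; lia.
rewrite prefix_cmp_cat -eval_cmp_factor // size1 drop_drop.
rewrite /cmp_pattern eval_Seq -/R1.
rewrite (eval_on_match _ _ (etrans (E1 rOne isT) one)); case: eqP => // _.
(* The first factor matched: [R2] is the memory once [rQ] has moved past it, and [R3] below the
   memory after the letter comparison made for an insertion. *)
pose R2 := upd R1 rQ (R1 rQ + R1 rI).
have E2 x : x < rQ -> R2 x = R x.
  by move=> ltx; rewrite /R2 /upd ltn_eqF // E1 // ltnW.
have Q2 : R2 rQ = R rI + R rQ by rewrite /R2 /upd /= !E1 // addnC.
pose R3 := eval T cmp_letter R2.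
have E3 x : x < rQ -> R3 x = R x.
  by move=> ltx; rewrite /R3 eval_cmp_letter_frame ?E2 // ltnW.
have Q3 : R3 rQ = R rI + R rQ by rewrite /R3 eval_cmp_letter_frame.
rewrite [LHS](_ : _ = if R2 rK < R2 rOne
  then eval T (on_match (Add rQ rQ rOne ;; cmp_factor rS2 rLen2)) R3 rOut
  else eval T (cmp_factor rS2 rLen2) R2 rOut); last first.
  by rewrite /cmp_rest eval_Seq eval_IfLt -/R2; case: ifP.
rewrite (E2 rK) // (E2 rOne) // one; case: ltnP => ltK; last first.
  by rewrite eval_cmp_factor ?Q2 ?E2.
rewrite prefix_cmp_cat -Q2 -[R rC]E2 // -(eval_cmp_letter (etrans (E2 rN isT) N)).
rewrite drop_drop -/R3.
rewrite (eval_on_match _ _ (etrans (E3 rOne isT) one)); case: eqP => // _.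
by rewrite eval_Seq eval_cmp_factor //= /upd /= ?Q3 ?Q2 !E3 // one addnC.
Qed.

(** * Correctness and running time of the binary search *)

Lemma bisect_step_untouched x : x < rLo -> untouched x bisect_step.
Proof.
move=> ltx; have N d : rLo <= d -> x != d.
  by move=> led; rewrite neq_ltn (leq_trans ltx led).
by rewrite /= !N.
Qed.

Lemma eval_bisect_step_frame T R x :
  x < rLo -> eval T bisect_step R x = R x.
Proof. by move/bisect_step_untouched; apply: eval_untouched. Qed.

(** The description of the pattern lives in registers below [rLeft], which the search never writes,
    so it is an invariant of the search. *)
Lemma well_formed_eq T R R' : (forall x, x < rLeft -> R' x = R x) ->
  well_formed T R -> well_formed T R' /\ decoded T R' = decoded T R.
Proof. by move=> E; rewrite /well_formed /decoded !E. Qed.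

Lemma eval_bisect_step T R (mid := (R rLo + R rHi)./2) :
  well_formed T R ->
  let less := prefix_cmp (nsuffix T mid) (decoded T R) < R rTh in
  eval T bisect_step R rLo = (if less then mid.+1 else R rLo) /\
  eval T bisect_step R rHi = (if less then R rHi else mid).
Proof.
move=> wf; pose R1 := upd (upd (upd R rMid (R rLo + R rHi)) rMid mid)
  rQ (nth 0 (SA T) mid).
have E1 x : x < rMid -> R1 x = R x.
  by move=> ltx; rewrite /R1 /upd !ltn_eqF // ltnW.
have [wf1 D1] : well_formed T R1 /\ decoded T R1 = decoded T R.
  by apply: well_formed_eq wf => x ltx; apply: E1; apply: leq_trans ltx _.
have E2 x : x < rQ -> eval T cmp_pattern R1 x = R1 x.
  move=> ltx; have N d : rQ <= d -> x != d.
    by move=> led; rewrite neq_ltn (leq_trans ltx led).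
  by rewrite eval_untouched //= !N.
have out2 := eval_cmp_pattern wf1; rewrite D1 in out2.
rewrite /bisect_step 4!eval_Seq -/R1.
move: (eval T cmp_pattern R1) E2 out2 => R2 E2 out2.
have mid2 : R2 rMid = mid by rewrite E2.
have one2 : R2 rOne = 1 by rewrite E2 //; case: wf1.
rewrite eval_IfLt out2 (E2 rTh) // (E1 rTh) //.
by case: ifP => _; rewrite /= /upd /= ?one2 ?mid2 ?E2 ?E1 ?addn1.
Qed.

Lemma monotone_boundary (f : nat -> nat) n th :
  (forall a b, a <= b -> b < n -> f a <= f b) ->
  exists2 c, c <= n & forall j, j < n -> (f j < th) = (j < c).
Proof.
elim: n => [|n IH] mono; first by exists 0.
(* If the last value is below [th], so are all others; otherwise the boundary of the first [n]
   values still works. *)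
case: (ltnP (f n) th) => [ltn_th|gen].
  exists n.+1 => // j ltj; rewrite ltj; apply: leq_ltn_trans ltn_th.
  exact: mono.
have [a b le_ab ltb|c lec bnd] := IH; first by apply: mono => //; apply: ltnW.
exists c => [|j]; first exact: ltnW.
rewrite ltnS leq_eqVlt => /predU1P[->|/bnd //].
by rewrite ltnNge gen ltnNge lec.
Qed.

Lemma exec_bisect_loop T c d R :
  well_formed T R ->
  (forall j, j < size T ->
    (prefix_cmp (nsuffix T j) (decoded T R) < R rTh) = (j < c)) ->
  R rLo <= c <= R rHi -> R rHi <= size T -> R rHi - R rLo < 2 ^ d ->
  exists t R', [/\ exec T (WhileLt rLo rHi bisect_step) R t R',
    t <= (d * (cost bisect_step).+1).+1 & R' rLo = c].
Proof.
elim: d R => [|d IH] R wf bnd /andP[lo_c c_hi] hi_n lt_d.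
  exists 1, R; split=> //; first by apply: exec_WhileLt_false; lia.
  by lia.
case: (ltnP (R rLo) (R rHi)) => [lt_lh|]; last first.
  by exists 1, R; split=> //; [apply: exec_WhileLt_false | lia].
have [t1 Et1 le_t1] := exec_eval T R (isT : loop_free bisect_step).
have [] := eval_bisect_step wf.
set R1 := eval T bisect_step R in Et1 *; set mid := _./2 => lo1 hi1.
have lo_mid : R rLo <= mid < R rHi by rewrite /mid; lia.
have E1 x : x < rLo -> R1 x = R x by apply: eval_bisect_step_frame.
have [wf1 D1] : well_formed T R1 /\ decoded T R1 = decoded T R.
  by apply: well_formed_eq wf => x ltx; apply: E1; apply: leq_trans ltx _.
move: lo1 hi1; rewrite bnd; last by lia.
move=> lo1 hi1.
have [||||t2 [R' [Et2 le_t2 lo']]] := IH R1 wf1.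
- by move=> j ltj; rewrite D1 E1 // bnd.
- by rewrite lo1 hi1; case: (ltnP mid c); lia.
- by rewrite hi1; case: ifP; lia.
(* Both [mid - rLo] and [rHi - mid.+1] are at most half of the old length, rounded down. *)
- by rewrite lo1 hi1; move: lt_d; rewrite expnS /mid; case: ifP; lia.
exists (t1 + t2).+1, R'; split=> //; first exact: exec_WhileLt_true Et1 Et2.
by rewrite mulSn; lia.
Qed.

Lemma exec_bisect T th R : well_formed T R ->
  exists t R', [/\ exec T (bisect th) R t R',
    t <= 4 + (trunc_log 2 (size T)).+1 * (cost bisect_step).+1,
    forall x, x < rTh -> R' x = R x,
    R' rLo <= size T &
    forall j, j < size T ->
      (prefix_cmp (nsuffix T j) (decoded T R) < th) = (j < R' rLo)].
Proof.
move=> wf.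
have [|c lec bnd] := @monotone_boundary
  (fun j => prefix_cmp (nsuffix T j) (decoded T R)) (size T) th.
  by move=> a b le_ab ltb; apply: prefix_cmp_mono; apply: suffix_array_mono.
pose R1 := upd (upd (upd R rTh th) rLo 0) rHi (R rN).
have E1 x : x < rTh -> R1 x = R x.
  by move=> ltx; rewrite /R1 /upd !ltn_eqF // (ltn_trans ltx).
have [wf1 D1] : well_formed T R1 /\ decoded T R1 = decoded T R.
  by apply: well_formed_eq wf => x ltx; apply: E1; apply: leq_trans ltx _.
have N : R rN = size T by case: wf.
(* The initial length |T| is less than 2 to the power [(trunc_log 2 (size T)).+1]. The 4 in the
   bound is three initialisations and the failing test. *)
have [||||t [R' [Et let1 lo']]] :=
    @exec_bisect_loop T c (trunc_log 2 (size T)).+1 R1 wf1.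
- by move=> j ltj; rewrite D1 bnd.
- by rewrite /R1 /upd /= N lec.
- by rewrite /R1 /upd /= N.
- by rewrite /R1 /upd /= N subn0 trunc_log_ltn.
exists (1 + (1 + (1 + t))), R'; split=> //; last 2 first.
- by rewrite lo'.
- by move=> j ltj; rewrite lo' bnd.
- apply: exec_Seq (exec_Const _ _ _ _) _.
  apply: exec_Seq (exec_Const _ _ _ _) _.
  exact: (exec_Seq (exec_Copy T rHi rN _) Et).
- move=> x ltx; rewrite (exec_untouched Et) ?E1 //.
  by apply: bisect_step_untouched; apply: leq_trans ltx _.
Qed.

(** * Suffix ranges before and after the edit *)

Lemma in_suffix_range_prefix Q T j :
  in_suffix_range Q T j = (j < size T) && prefix Q (nsuffix T j).
Proof.
rewrite /in_suffix_range /occurs_at; case: ltnP => //= ltj.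
by rewrite -mem_suffix_array mem_nth ?size_suffix_array.
Qed.

Lemma occursP Q T : occurs Q T <-> exists j, in_suffix_range Q T j.
Proof.
split=> [[p /andP[ltp Qp]]|[j /andP[_ Qj]]]; last by eexists; exact: Qj.
have [ltj pj] := nth_inverse_suffix_array ltp.
by exists (nth 0 (inverse_suffix_array T) p); rewrite in_suffix_range_prefix ltj pj.
Qed.

Lemma locate_factors_correct T P l r i e
    (R := eval T locate_factors (input T (size P) l r i e)) :
  occurs P T -> edit_valid P i e -> suffix_range P T l r ->
  well_formed T R /\ decoded T R = apply_edit P i e.
Proof.
move=> occP valid [/(_ occP) range _].
(* Since [P] occurs, its range is nonempty and contains its left end, so SA[l] is an occurrence. *)
have /andP[ltl /andP[_ Pl]] : in_suffix_range P T l.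
  have [j] := (occursP P T).1 occP; rewrite !range; lia.
set s := nth 0 (SA T) l in Pl.
have defP : P = take (size P) (drop s T) by apply/esym/eqP; rewrite -prefixE.
have lePT : s + size P <= size T.
  have lts : s < size T by rewrite -mem_suffix_array mem_nth ?size_suffix_array.
  by rewrite -leq_subRL ?(ltnW lts) // -size_drop; apply: size_prefix Pl.
have takeP : i <= size P -> take i P = take i (drop s T).
  by move=> lei; rewrite {1}defP take_takel.
have dropP j : j <= size P -> drop j P = take (size P - j) (drop (s + j) T).
  by move=> lej; rewrite addnC -drop_drop take_drop subnK // -defP.
(* What remains is to read both pieces of [P] as factors of [T] relative to [s]. *)
rewrite /R /well_formed /decoded /= /upd /= /input /= -/s.
case: e valid {R} => [c|] /= lei.
  by rewrite !addn0 !subn0 takeP // dropP //; split=> //; split=> //; lia.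
rewrite (takeP (ltnW lei)) (dropP _ lei) -subnDA -[s + i + 1]addnA !addn1.
by split=> //; split=> //; lia.
Qed.

(** A suffix has prefix [Q] iff its code is below 2 but not below 1, so the two boundaries delimit
    the range. If they leave it empty, [Q] does not occur and the range must be written as 0, 0. *)
Lemma output_range_correct Q T R :
  (forall j, j < size T -> (prefix_cmp (nsuffix T j) Q < 1) = (j < R rLeft)) ->
  R rLo <= size T ->
  (forall j, j < size T -> (prefix_cmp (nsuffix T j) Q < 2) = (j < R rLo)) ->
  suffix_range Q T (eval T output_range R 0) (eval T output_range R 1).
Proof.
move=> bndL leR bndR.
have range j : in_suffix_range Q T j = (R rLeft <= j < R rLo).
  rewrite in_suffix_range_prefix -prefix_cmp_eq1.
  case: (ltnP j (size T)) => [ltj|gej] /=; last by lia.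
  by rewrite -bndR // leqNgt -bndL //; case: prefix_cmp => [|[|]].
rewrite /output_range /=; case: ltnP => [ltLR|leRL]; rewrite /upd /=.
  by split=> // -[]; apply/occursP; exists (R rLeft); rewrite range leqnn.
by split=> // /occursP[j]; rewrite range; lia.
Qed.

Theorem theorem2 (k : nat) :
  exists (p : prog) (C : nat),
  forall (T P : string) (l r i : nat) (e : edit),
    (forall a, a \in T ++ edit_letters e -> a <= size T ^ k) ->
    occurs P T ->
    edit_valid P i e ->
    suffix_range P T l r ->
    exists (t : nat) (R : memory),
      [/\ exec T p (input T (size P) l r i e) t R,
          t <= C * (trunc_log 2 (size T)).+1
        & suffix_range (apply_edit P i e) T (R 0) (R 1)].
Proof.
(* Outside the rounds of the two searches at most 6 + 4 + 1 + 4 + 3 = 18 steps are made, which 20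
   covers because the logarithmic factor is at least 1. *)
exists search_edited, (20 + 2 * (cost bisect_step).+1).
move=> T P l r i e _ occP valid range.
have [wf0 <-] := locate_factors_correct occP valid range.
have [t0] := exec_eval T (input T (size P) l r i e)
  (isT : loop_free locate_factors).
set R0 := eval _ _ _ in wf0 * => Et0 le0.
have [t1 [R1 [Et1 le1 E1 _ bnd1]]] := exec_bisect 1 wf0.
pose R2 := upd R1 rLeft (R1 rLo).
have E2 x : x < rLeft -> R2 x = R0 x.
  by move=> ltx; rewrite /R2 /upd ltn_eqF // E1 // ltnW.
have [wf2 D2] := well_formed_eq E2 wf0.
have [t3 [R3 [Et3 le3 E3 leR3 bnd3]]] := exec_bisect 2 wf2.
have [t4 Et4 le4] := exec_eval T R3 (isT : loop_free output_range).
exists (t0 + (t1 + (1 + (t3 + t4)))), (eval T output_range R3); split.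
- apply: exec_Seq Et0 _; apply: exec_Seq Et1 _.
  by apply: exec_Seq (exec_Copy _ _ _ _) _; apply: exec_Seq Et3 Et4.
- move: le0 le1 le3 le4; rewrite [cost locate_factors]/= [cost output_range]/=.
  by move: (cost bisect_step).+1 (trunc_log 2 (size T)) => c d; nia.
- apply: output_range_correct => // j ltj; last by rewrite -bnd3 // D2.
  by rewrite E3 // bnd1.
Qed.
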